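(* Let $p$ be a prime, $k$ a positive integer, and $q=p^k$ with $q\equiv 1\pmod 3$. Let $n$ be a positive integer with $\gcd\big(n,\frac{q-1}{3}\big)=1$. Then the number of elements $a\in\mathbb{F}_q$ for which $x^n\big(x^{\frac{q-1}{3}}+a\big)$ is a permutation polynomial of $\mathbb{F}_q$ equals $$\frac{2q-3(\epsilon_1+\epsilon_2)-10-2\big(\pi_p^{\,k}+\overline{\pi_p}^{\,k}\big)}{9},$$ where $\epsilon_1=-2$ if $q-3n\equiv 1\pmod 9$ and $\epsilon_1=1$ otherwise, and $\epsilon_2=-2$ if $n\equiv 0\pmod 3$ and $\epsilon_2=1$ otherwise.
   Context: A polynomial is a permutation polynomial of $\mathbb{F}_q$ if it induces a bijection of $\mathbb{F}_q$. Note $q\equiv1\pmod 3$ forces $p\neq3$. For a prime $p\neq 3$ define the integer $\kappa_p$ as follows: $\kappa_7=1$, $\kappa_{13}=-5$; if $p\equiv 1\pmod 3$ and $p\ge 19$, $\kappa_p$ is the unique integer with $|\kappa_p|\le 2\sqrt p$ and $\kappa_p\equiv-\binom{\frac{p-1}{2}}{\frac{p-1}{3}}\cdot 4^{-\frac{p-1}{6}}\pmod p$; if $p\equiv 2\pmod 3$ (including $p=2$), $\kappa_p=0$. Define the complex number $\pi_p=\frac{-\kappa_p}{2}+i\sqrt{p-\frac{\kappa_p^2}{4}}$, and $\overline{\pi_p}$ its complex conjugate. *)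

(* Defs.v *)
From HB Require Import structures.
From mathcomp Require Import all_boot all_order all_algebra all_field.
Set Implicit Arguments. Unset Strict Implicit. Unset Printing Implicit Defensive.
Import Order.TTheory GRing.Theory Num.Theory.
Local Open Scope ring_scope.

(* A polynomial P over a finite field F is a permutation polynomial if the
   induced map x |-> P.[x] is a bijection of F; on a finite type this is
   the same as injectivity, which we use to get a boolean predicate. *)
Definition is_permpoly (F : finFieldType) (P : {poly F}) : bool :=
  injectiveb (fun x : F => P.[x]).

Definition kappa_ok (p : nat) (z : int) : bool :=
  (`|(z%:~R : algC)| <= 2 * sqrtC (p%:R))
  && ((z%:~R : 'F_p) ==
        - ('C((p.-1)./2, (p.-1) %/ 3))%:R / (4%:R ^+ ((p.-1) %/ 6))).

(* Any z with |z| <= 2 sqrt p lies in [-2p, 2p]; take the (unique) one found. *)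
Definition kappa_search (p : nat) : int :=
  head 0 [seq z <- [seq (i%:Z - (2 * p)%:Z)%R | i <- iota 0 (4 * p).+1]
         | kappa_ok p z].

Definition kappa (p : nat) : int :=
  if p == 7%N then 1
  else if p == 13%N then -5
  else if (p %% 3 == 1)%N then kappa_search p
  else 0.

Definition pi_p (p : nat) : algC :=
  - (kappa p)%:~R / 2%:R
  + 'i * sqrtC (p%:R - ((kappa p)%:~R ^+ 2) / 4%:R).

(* Main.v *)
(* Write q = 3s + 1 and let w be a primitive cube root of unity in F.  The
   polynomial x^n (x^s + a) permutes F iff y^n (y + a)^s permutes the cube roots
   of unity; with t = - w (w + a) / (1 + a) this prescribes the cubic residue
   classes of t and 1 - t, so the count is 2 A plus congruence corrections, where
   A is the number of t such that t and 1 - t are both nonzero cubes.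
   Linear relations between the cyclotomic numbers of order 3 express A through
   the real part of the cubic Jacobi sum J_q in Z[omega], which has norm q and is
   congruent to -1 modulo 3.  Hasse-Davenport, - J_q = (- J_p)^k, is obtained by
   factoring in Z[omega]: J_q has norm p^k and, by power sums in F, avoids one
   of the two primes above p (its reduction is - 'C(2s, s)), so it is a unit times
   a power of J_p, and the congruence modulo 3 pins the unit.  If p = 2 mod 3,
   p is inert and - J_q = (- p)^(k/2).  Finally kappa_p = 2 Re J_p since
   'C(4m, 2m) = 16^m 'C(3m, 2m) modulo p = 6m + 1. *)
Require Import Defs.
From HB Require Import structures.
From mathcomp Require Import all_boot all_order all_algebra all_field.
From mathcomp Require Import zify ring.
Import Order.TTheory GRing.Theory Num.Theory.
Set Implicit Arguments. Unset Strict Implicit. Unset Printing Implicit Defensive.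
Local Open Scope ring_scope.

(** * Descent in Z[omega] *)

(** Four times the norm is [(2 * a - b) ^+ 2 + 3 * b ^+ 2], so [b = 3 * x] leaves
    [4 - 27 * x ^+ 2 >= 0]. The congruence on [a] selects 1 among the units 1 and -1; both descents
    end here. *)
Lemma eisenstein_norm1 (a b : int) : a ^+ 2 - a * b + b ^+ 2 = 1 ->
  (3 %| a - 1)%Z -> (3 %| b)%Z -> a = 1 /\ b = 0.
Proof.
move=> Nab a3 /dvdzP[x Hx].
have E : (2 * a - b) ^+ 2 = 4 - 27 * x ^+ 2.
  transitivity (4 * (a ^+ 2 - a * b + b ^+ 2) - 27 * x ^+ 2); first by rewrite Hx; ring.
  by rewrite Nab mulr1.
have x0 : x = 0.
  apply/eqP; rewrite -sqrf_eq0; apply/eqP.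
  move: E (sqr_ge0 (2 * a - b)) (sqr_ge0 x); clear.
  by move: (_ ^+ 2) (x ^+ 2) => u v; lia.
have b0 : b = 0 by rewrite Hx x0 mul0r.
have /eqP : a ^+ 2 = 1 by move: Nab; rewrite b0 => <-; ring.
by rewrite sqrf_eq1 => /orP[] /eqP a1; [|move: a3; rewrite a1].
Qed.

Section EisensteinDescent.
Variables (p : nat) (r : int).
Hypotheses (p_pr : prime p) (r_root : (p %| r ^+ 2 + r + 1)%Z).

Let p0 : p%:Z != 0. Proof. by have := prime_gt0 p_pr; lia. Qed.

Lemma prime_dvdzM (a b : int) : (p %| a * b)%Z = (p %| a)%Z || (p %| b)%Z.
Proof. by rewrite !dvdzE abszM /= Euclid_dvdM. Qed.

(** Modulo [p] the roots of [x ^+ 2 + x + 1] are [r] and [- (1 + r)], and the norm is the product of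
    the values of [a + b * x] at the two roots. *)
Lemma eisenstein_dvd_conj (a b : int) : (p %| a ^+ 2 - a * b + b ^+ 2)%Z ->
  ~~ (p %| a - b * (1 + r))%Z -> (p %| a + b * r)%Z.
Proof.
move=> pN pab.
suff : (p %| (a + b * r) * (a - b * (1 + r)))%Z by rewrite prime_dvdzM (negPf pab) orbF.
have -> : (a + b * r) * (a - b * (1 + r)) =
  (a ^+ 2 - a * b + b ^+ 2) - b ^+ 2 * (r ^+ 2 + r + 1) by ring.
by rewrite rpredB // dvdz_mull.
Qed.

(* Dividing [a + bζ] by [c + dζ] means multiplying by the conjugate
   [c + dζ^2] and dividing by [p]; the residue [r] of [ζ] tells which of the
   two primes above [p] divides which element. *)
Lemma eisenstein_descent (c d : int) (a b : int) (k : nat) :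
  c ^+ 2 - c * d + d ^+ 2 = p%:Z -> (3 %| c - 1)%Z -> (3 %| d)%Z ->
  ~~ (p %| c - d * (1 + r))%Z ->
  a ^+ 2 - a * b + b ^+ 2 = (p ^ k)%N%:Z -> (3 %| a - 1)%Z -> (3 %| b)%Z ->
  ~~ (p %| a - b * (1 + r))%Z ->
  forall z : algC, z ^+ 2 + z + 1 = 0 ->
    a%:~R + b%:~R * z = (c%:~R + d%:~R * z) ^+ k.
Proof.
move=> Ncd c3 d3 pcd.
have /dvdzP[l Hl] : (p %| c + d * r)%Z by apply: eisenstein_dvd_conj; rewrite ?Ncd.
have /dvdzP[t Ht] := r_root.
elim: k a b => [|k IH] a b Nab a3 b3 pab z zr.
  by have [-> ->] := eisenstein_norm1 Nab a3 b3; rewrite mul0r addr0 expr0.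
have /dvdzP[m Hm] : (p %| a + b * r)%Z.
  by apply: eisenstein_dvd_conj; rewrite // Nab expnS PoszM dvdz_mulr.
have Ea : a = m * p%:Z - b * r by rewrite -Hm addrK.
have Ec : c = l * p%:Z - d * r by rewrite -Hl addrK.
(* Once [a] and [c] are eliminated, the terms without a factor [p] add up to
   [b * d * (r ^+ 2 + r + 1)], whence [t] in the witness. *)
have [a' Ha'] : exists a', a * c + b * d - a * d = a' * p%:Z.
  exists (m * l * p%:Z - m * d * r - l * b * r - m * d + b * d * t).
  apply/eqP; rewrite -subr_eq0; apply/eqP.
  transitivity (b * d * ((r ^+ 2 + r + 1) - t * p%:Z)); last by rewrite Ht subrr mulr0.
  by rewrite Ea Ec; ring.
have [b' Hb'] : exists b', b * c - a * d = b' * p%:Z.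
  by exists (b * l - m * d); rewrite Ea Ec; ring.
have Eab : a = a' * c - b' * d.
  apply: (mulIf p0); rewrite -{1}Ncd mulrBl.
  rewrite [a' * c * _]mulrAC [b' * d * _]mulrAC -Ha' -Hb'; ring.
have Ebb : b = a' * d + b' * c - b' * d.
  apply: (mulIf p0); rewrite -{1}Ncd mulrBl mulrDl.
  rewrite [a' * d * _]mulrAC [b' * c * _]mulrAC [b' * d * _]mulrAC -Ha' -Hb'; ring.
have [x Hx] := dvdzP b3; have [y Hy] := dvdzP d3.
have [u Eu] := dvdzP a3; have Hu : a = u * 3 + 1 by rewrite -Eu subrK.
have [v Ev] := dvdzP c3; have Hv : c = v * 3 + 1 by rewrite -Ev subrK.
(* As [p] is 1 modulo 3, division by it preserves residues modulo 3, which passes the congruences on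
   to [a'] and [b']. *)
have [e He] : exists e, p%:Z = e * 3 + 1.
  exists (3 * v ^+ 2 + 2 * v - (v * 3 + 1) * y + 3 * y ^+ 2).
  by rewrite -Ncd Hy Hv; ring.
have a'3 : (3 %| a' - 1)%Z.
  apply/dvdzP; exists (3 * u * v + u + v + 3 * x * y - (u * 3 + 1) * y - a' * e).
  transitivity (a' * p%:Z - 1 - a' * e * 3); first by rewrite He; ring.
  by rewrite -Ha' Hu Hv Hx Hy; ring.
have b'3 : (3 %| b')%Z.
  apply/dvdzP; exists (x * c - a * y - b' * e).
  transitivity (b' * p%:Z - b' * e * 3); first by rewrite He; ring.
  by rewrite -Hb' Hx Hy; ring.
have Nab' : a' ^+ 2 - a' * b' + b' ^+ 2 = (p ^ k)%N%:Z.
  apply: (mulIf p0); rewrite -PoszM mulnC -expnS -Nab -Ncd Eab Ebb.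
  by clear; ring.
(* Evaluation at [- (1 + r)] is multiplicative modulo [p]: if it killed the quotient, it would kill
   the dividend too. *)
have pab' : ~~ (p %| a' - b' * (1 + r))%Z.
  apply: contra pab => /dvdzP[f Hf].
  apply/dvdzP; exists (f * (c - d * (1 + r)) - b' * d * t).
  apply/eqP; rewrite -subr_eq0; apply/eqP.
  transitivity ((a' - b' * (1 + r) - f * p%:Z) * (c - d * (1 + r))
     - b' * d * ((r ^+ 2 + r + 1) - t * p%:Z)); last by rewrite Ht Hf !subrr mulr0 mul0r subr0.
  by rewrite Eab Ebb; ring.
rewrite exprSr -(IH a' b') // {1}Eab {1}Ebb !rmorphD !rmorphN !rmorphM /=.
have Hz : z ^+ 2 = - z - 1 by rewrite -[LHS](subr0) -zr; ring.
transitivity (a'%:~R * c%:~R + a'%:~R * d%:~R * z + b'%:~R * c%:~R * z + b'%:~R * d%:~R * z ^+ 2).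
  by rewrite Hz; ring.
by ring.
Qed.
End EisensteinDescent.

(** Otherwise [- a / b] would be a primitive cube root of unity modulo [p], which [z ^+ p = z] rules
    out when [p] is 2 modulo 3. *)
Lemma inert_dvd (p : nat) (a b : int) : prime p -> (p %% 3 = 2)%N ->
  (p %| a ^+ 2 - a * b + b ^+ 2)%Z -> (p %| a)%Z /\ (p %| b)%Z.
Proof.
move=> p_pr p3 pN; have Fp0 (x : int) : (p %| x)%Z = ((x%:~R : 'F_p) == 0).
  by rewrite (dvdz_pcharf (pchar_Fp p_pr)).
move: pN; rewrite !Fp0 !rmorphD !rmorphN !rmorphM /=.
move: (a%:~R : 'F_p) (b%:~R : 'F_p) => x y xy.
have y0 : y = 0.
  apply/eqP; apply/negP => /negP y0.
  pose z := - (x / y).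
  have z1 : z ^+ 2 + z + 1 = 0.
    apply: (mulIf (expf_neq0 2 y0)); rewrite mul0r -(eqP xy) /z; field.
    exact: y0.
  have z3 : z ^+ 3 = 1.
    have : (z - 1) * (z ^+ 2 + z + 1) = 0 by rewrite z1 mulr0.
    by move=> E; apply/eqP; rewrite -subr_eq0 -E; apply/eqP; ring.
  have zp : z ^+ p = z by have := expf_card z; rewrite (card_Fp p_pr).
  have z2 : z ^+ 2 = z.
    have Ep : p = (3 * (p %/ 3) + 2)%N by rewrite {1}(divn_eq p 3) p3 mulnC.
    have : z ^+ p = z ^+ (3 * (p %/ 3) + 2) by congr (z ^+ _).
    by rewrite zp exprD exprM z3 expr1n mul1r.
  have : z = 1.
    move/eqP: z2; rewrite -subr_eq0 expr2 -{3}[z]mulr1 -mulrBr mulf_eq0 subr_eq0.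
    case/orP=> /eqP // z0; move: z1; rewrite z0 => /eqP.
    by rewrite expr0n !add0r oner_eq0.
  move=> E; move: z1; rewrite E expr1n => /eqP.
  have -> : 1 + 1 + 1 = 3%:R :> 'F_p by rewrite -addrA.
  rewrite -(dvdn_pcharf (pchar_Fp p_pr)) => p3'.
  have := dvdn_leq (isT : (0 < 3)%N) p3'.
  by case: p p_pr p3 p3' {Fp0 x y z xy y0 z3 zp z2 E} => [|[|[|[|]]]].
by move: xy; rewrite y0 !mulr0 oppr0 !addr0 mulf_eq0 orbb eqxx.
Qed.

(** An inert [p] divides both coordinates. The quotient is taken by [- p], which is 1 modulo 3, so
    the congruences survive each step. *)
Lemma inert_descent (p m : nat) (a b : int) : prime p -> (p %% 3 = 2)%N ->
  a ^+ 2 - a * b + b ^+ 2 = (p ^ (2 * m))%N%:Z -> (3 %| a - 1)%Z -> (3 %| b)%Z ->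
  a = (- p%:Z) ^+ m /\ b = 0.
Proof.
move=> p_pr p3; have p0 : p%:Z != 0 by have := prime_gt0 p_pr; lia.
have [e He] : exists e, p%:Z = e * 3 - 1.
  by exists (p %/ 3).+1%:Z; have := divn_eq p 3; rewrite p3; lia.
elim: m a b => [|m IH] a b Nab a3 b3; first exact: eisenstein_norm1.
have [/dvdzP[x Hx] /dvdzP[y Hy]] : (p %| a)%Z /\ (p %| b)%Z.
  by apply: inert_dvd => //; rewrite Nab mulnS expnS PoszM dvdz_mulr.
have [u Hu] := dvdzP a3; have [v Hv] := dvdzP b3.
have [] := IH (- x) (- y).
- apply: (mulIf p0); apply: (mulIf p0).
  have -> : (p ^ (2 * m))%N%:Z * p%:Z * p%:Z = (p ^ (2 * m.+1))%N%:Z.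
    by rewrite -!PoszM mulnS !expnS mulnC [(_ * p)%N]mulnC.
  by rewrite -Nab Hx Hy; ring.
- apply/dvdzP; exists (u - x * e).
  by apply/eqP; rewrite -subr_eq0 mulrBl -Hu Hx He; apply/eqP; ring.
- apply/dvdzP; exists (v - y * e).
  by apply/eqP; rewrite -subr_eq0 mulrBl -Hv Hy He; apply/eqP; ring.
by move=> xE /eqP; rewrite oppr_eq0 Hx Hy exprSr -xE => /eqP ->; rewrite mul0r mulrNN.
Qed.

(** * Cubic residues and cyclotomic numbers of order 3 *)

Lemma cubic_sum0 (R : idomainType) (x : R) :
  x ^+ 3 = 1 -> x != 1 -> x ^+ 2 + x + 1 = 0.
Proof.
move=> x3 x1; apply: (mulfI (_ : x - 1 != 0)); first by rewrite subr_eq0.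
by rewrite mulr0 -[RHS](subrr 1) -{3}x3; ring.
Qed.

Lemma cubic_sqr_sum0 (R : idomainType) (x : R) :
  x ^+ 3 = 1 -> x != 1 -> (x ^+ 2) ^+ 2 + x ^+ 2 + 1 = 0.
Proof.
move=> x3 x1; rewrite -(cubic_sum0 x3 x1) -exprM (exprD x 3 1) x3 mul1r expr1.
by rewrite [x + _]addrC.
Qed.

Lemma ex_cubic_root_algC : exists2 z : algC, z ^+ 3 = 1 & z != 1.
Proof.
have [z z_prim] := C_prim_root_exists (isT : (0 < 3)%N).
exists z; first exact: prim_expr_order z_prim.
by have := prim_order_dvd z_prim 1; rewrite expr1 => <-.
Qed.

(** Translation by 1 permutes [F] and adds [#|F|%:R] to the sum of all elements. *)
Lemma card_natr_eq0 (F : finFieldType) : #|F|%:R = 0 :> F.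
Proof.
have E : \sum_(x : F) x = \sum_(x : F) x + #|F|%:R.
  rewrite [LHS](reindex_inj (addIr 1)) big_split /=; congr (_ + _).
  by rewrite sumr_const cardT.
by apply: (addrI (\sum_(x : F) x)); rewrite -E addr0.
Qed.

Lemma expf_card_pred (F : finFieldType) (m : nat) (x : F) :
  #|F| = m.+1 -> x != 0 -> x ^+ m = 1.
Proof.
move=> cardF x0; apply: (mulfI x0).
by rewrite -exprS -cardF expf_card mulr1.
Qed.

Lemma card_expr_eq (F : finFieldType) (m : nat) (c : F) :
  (0 < m)%N -> (#|[set x : F | x ^+ m == c]| <= m)%N.
Proof.
move=> m0; rewrite cardE.
have sP : size ('X^m - c%:P) = m.+1 by rewrite size_XnsubC.
have := @max_poly_roots _ ('X^m - c%:P) (enum [set x : F | x ^+ m == c]).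
rewrite sP ltnS; apply.
- by rewrite -size_poly_eq0 sP.
- apply/allP=> x; rewrite mem_enum inE => /eqP xm.
  by rewrite /root !hornerE xm subrr.
- exact: enum_uniq.
Qed.

Lemma ex_expr_neq1 (F : finFieldType) (m : nat) :
  (0 < m)%N -> (m.+1 < #|F|)%N -> exists2 x : F, x != 0 & x ^+ m != 1.
Proof.
move=> m0 mF.
case: (pickP (fun x : F => (x != 0) && (x ^+ m != 1))) => [x /andP[]|E]; first by exists x.
have : (#|[set: F]| <= #|0%R |: [set x : F | x ^+ m == 1%R]|)%N.
  apply/subset_leq_card/subsetP => x _; rewrite !inE.
  by have := E x; case: eqP => //= _ /negbFE.
rewrite cardsT leqNgt => /negP[]; apply: leq_ltn_trans mF.
by rewrite (leq_trans (leq_card_setU _ _)) // cards1 add1n ltnS card_expr_eq.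
Qed.

(** For [#|F| = 3 * s + 1] these are the cyclotomic numbers of order 3. Classes are labelled by the
    cube root of unity [t ^+ s] in [F], so no generator is fixed. *)
Definition cyc (F : finFieldType) (s : nat) (a b : F) : nat :=
  #|[set t : F | (t ^+ s == a) && ((1 - t) ^+ s == b)]|.

Arguments cyc {F} s%_nat_scope (a b)%_ring_scope.

Section CubicResidues.
Variables (F : finFieldType) (s : nat) (w : F).
Hypotheses (cardF : #|F| = (3 * s).+1) (w3 : w ^+ 3 = 1) (w1 : w != 1).

Lemma residue_index_gt0 : (0 < s)%N.
Proof. by have := finNzRing_gt1 F; rewrite cardF; case: s. Qed.

Lemma cubic_neq0 : w != 0.
Proof. by apply: contra_eq_neq w3 => ->; rewrite expr0n eq_sym oner_eq0. Qed.

Lemma three_neq0 : 3%:R != 0 :> F.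
Proof.
apply/eqP => E; have /eqP := card_natr_eq0 F.
by rewrite cardF -addn1 natrD natrM E mul0r add0r oner_eq0.
Qed.

Lemma cubic_sqr_neq : (w ^+ 2 != 1) * (w ^+ 2 != w).
Proof.
have w0 := cubic_neq0; split; apply: contra w1 => /eqP E.
  by rewrite -w3 exprS E mulr1.
by apply/eqP/(mulfI w0); rewrite -expr2 mulr1.
Qed.

Lemma uniq_cubic : uniq [:: 1; w; w ^+ 2].
Proof.
by rewrite /= !inE negb_or !(eq_sym _ (w ^+ 2)) (eq_sym 1) w1 !cubic_sqr_neq.
Qed.

Lemma cubic_mem (x : F) : (x \in [:: 1; w; w ^+ 2]) = (x ^+ 3 == 1).
Proof.
rewrite !inE -[x ^+ 3 == 1]subr_eq0.
have -> : x ^+ 3 - 1 = (x - 1) * ((x - w) * (x - w ^+ 2)).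
  have Ew : w ^+ 2 = - w - 1 by rewrite -[LHS](subr0) -(cubic_sum0 w3 w1); ring.
  transitivity (x ^+ 3 - w ^+ 3); first by rewrite w3.
  transitivity ((x - 1) * (x ^+ 2 - (w ^+ 2 + w) * x + w ^+ 3)); last by ring.
  rewrite w3 Ew; ring.
by rewrite !mulf_eq0 !subr_eq0.
Qed.

Lemma expr_residue (x : F) : x != 0 -> x ^+ s \in [:: 1; w; w ^+ 2].
Proof.
by move=> x0; rewrite cubic_mem -exprM mulnC; apply/eqP/expf_card_pred.
Qed.

Lemma expr0_residue : 0 ^+ s = 0 :> F.
Proof. by rewrite expr0n gtn_eqF // residue_index_gt0. Qed.

Lemma exprN1_residue : (-1) ^+ s = 1 :> F.
Proof.
have := expr_residue (_ : -1 != 0).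
rewrite oppr_eq0 oner_eq0 cubic_mem -exprM mulnC exprM => /(_ isT).
by rewrite exprS expr2 mulrNN mulr1 mulr1 => /eqP.
Qed.

(** Each class has at most [s] elements by degree, while the three together exhaust the [3 * s]
    nonzero elements. *)
Lemma card_residue (c : F) : c \in [:: 1; w; w ^+ 2] -> #|[set x : F | x ^+ s == c]| = s.
Proof.
move=> cP; pose f c := [set x : F | x ^+ s == c].
have le (d : F) : (#|f d| <= s)%N by apply/card_expr_eq/residue_index_gt0.
have : (3 * s <= #|f 1%R| + #|f w| + #|f (w ^+ 2)%R|)%N.
  have -> : (3 * s)%N = #|[set~ (0 : F)]| by rewrite cardsC1 cardF.
  apply: leq_trans (leq_trans (leq_card_setU (f 1 :|: f w) (f (w ^+ 2))) _); last first.
    by rewrite leq_add2r leq_card_setU.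
  apply/subset_leq_card/subsetP=> x; rewrite !inE => x0.
  by have := expr_residue x0; rewrite !inE orbA.
have := le 1; have := le w; have := le (w ^+ 2).
move: cP; rewrite !inE -/(f c) => /or3P[] /eqP ->; lia.
Qed.

(** The vanishing of [h] discards [t = 0] and [t = 1], the only points outside the nine classes. *)
Lemma cyc_sum (V : nmodType) (h : F -> F -> V) :
  (forall a, h a 0 = 0) -> (forall b, h 0 b = 0) ->
  \sum_(t : F) h (t ^+ s) ((1 - t) ^+ s) =
  \sum_(a <- [:: 1; w; w ^+ 2]) \sum_(b <- [:: 1; w; w ^+ 2]) h a b *+ cyc s a b.
Proof.
move=> h0r h0l.
have E (x : F) (g : F -> V) : g 0 = 0 ->
    g (x ^+ s) = \sum_(a <- [:: 1; w; w ^+ 2]) if x ^+ s == a then g a else 0.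
  move=> g0; have [->|x0] := eqVneq x 0.
    rewrite expr0_residue g0 big_seq big1 // => a.
    by move=> _; case: eqP => // <-.
  rewrite (bigD1_seq (x ^+ s)) ?expr_residue ?uniq_cubic //= eqxx big1 ?addr0 // => a.
  by rewrite eq_sym => /negPf ->.
transitivity (\sum_(t : F) \sum_(a <- [:: 1; w; w ^+ 2]) \sum_(b <- [:: 1; w; w ^+ 2])
   if (t ^+ s == a) && ((1 - t) ^+ s == b) then h a b else 0).
  apply: eq_bigr => t _; rewrite (E t (h^~ ((1 - t) ^+ s))) //.
  apply: eq_bigr => a _; case: eqP => _ /=; last by rewrite big1.
  exact: E.
rewrite exchange_big /=; apply: eq_bigr => a _.
rewrite exchange_big /=; apply: eq_bigr => b _.
by rewrite -big_mkcond sumr_const /cyc cardsE.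
Qed.

Lemma cycC (a b : F) : cyc s a b = cyc s b a.
Proof.
rewrite /cyc -!sum1_card (reindex_inj (_ : injective (fun t => 1 - t))).
  by apply: eq_bigl => t; rewrite !inE opprB addrCA subrr addr0 andbC.
by move=> x y /addrI /oppr_inj.
Qed.

(** Substitution of [t^-1] for [t]: [1 - t^-1] is [-1] times [(1 - t) / t], and [-1] is a cube. *)
Lemma cycV (a b : F) : a != 0 -> cyc s a b = cyc s a^-1 (b / a).
Proof.
move=> a0; rewrite /cyc -!sum1_card (reindex_inj invr_inj).
apply: eq_bigl => t; rewrite !inE; have [->|t0] := eqVneq t 0.
  by rewrite invr0 expr0_residue !(eq_sym 0) invr_eq0 (negPf a0).
rewrite exprVn -{1}[a]invrK (inj_eq invr_inj); case: eqP => //= ta.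
have -> : 1 - t^-1 = -1 * ((1 - t) / t) by field.
rewrite !exprMn exprN1_residue mul1r exprVn ta invrK.
by rewrite -(inj_eq (mulIf a0) (_ ^+ _)) mulfVK.
Qed.

(** For [t] in class [a], [1 - t] falls into one of the three classes unless [t = 1], a point of
    class 1; hence the correction term. *)
Lemma cyc_row (a : F) : a \in [:: 1; w; w ^+ 2] ->
  (cyc s a 1 + cyc s a w + cyc s a (w ^+ 2) + (a == 1%R))%N = s.
Proof.
move=> aP; rewrite -{4}(card_residue aP).
have -> : nat_of_bool (a == 1) = (\sum_(t : F) ((t == 1%R) && (a == 1%R)))%N.
  by rewrite (bigD1 (1 : F)) //= eqxx big1 ?addn0 // => t /negPf ->.
rewrite /cyc -!sum1_card; rewrite ![\sum_(_ in [set _ | _]) _]big_mkcond /= -!big_split /=.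
apply: eq_bigr => t _; rewrite !inE; have [->|t1] := eqVneq t 1.
  rewrite subrr expr0_residue expr1n !(eq_sym 0) oner_eq0 expf_eq0 (negPf cubic_neq0).
  by rewrite (eq_sym 1); case: eqP.
rewrite addn0; case: eqP => //= _.
have yP : (1 - t) ^+ s \in [:: 1; w; w ^+ 2].
  by apply: expr_residue; rewrite subr_eq0 eq_sym.
have := count_uniq_mem ((1 - t) ^+ s) uniq_cubic; rewrite yP /= addn0 addnA.
by rewrite !(eq_sym _ ((1 - t) ^+ s)).
Qed.

Lemma cubic_inv : (w^-1 = w ^+ 2) * ((w ^+ 2)^-1 = w).
Proof.
have w0 := cubic_neq0; split; apply: (mulfI w0).
  by rewrite mulfV // -exprS.
by rewrite expr2 invfM mulrA mulfV // mul1r -[LHS]mul1r -w3 !exprS expr0; field.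
Qed.

Lemma cyc_ww : (cyc s (w ^+ 2) (w ^+ 2) = cyc s 1 w) * (cyc s w w = cyc s 1 (w ^+ 2)).
Proof.
have w0 := cubic_neq0; rewrite !(cycC 1); split.
  by rewrite [RHS]cycV // div1r !cubic_inv.
by rewrite [RHS]cycV ?expf_neq0 // div1r !cubic_inv.
Qed.

(** By the symmetries the rows of [1] and [w] share two entries, and only the row of [1] loses a
    point. All nine numbers are thereby reduced to three. *)
Lemma cyc_w1w2 : cyc s w (w ^+ 2) = (cyc s (1 : F) 1).+1.
Proof.
have := cyc_row (mem_head (1 : F) [:: w; w ^+ 2]); have := cyc_row (_ : w \in [:: 1; w; w ^+ 2]).
rewrite !inE eqxx orbT (negPf w1) eqxx => /(_ isT).
by rewrite (cycC w 1) !cyc_ww; lia.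
Qed.

(** Coordinates of the cubic Jacobi sum in the basis 1, omega: [jacobi_re] is the coefficient of 1,
    and the real part is [jacobi_re - jacobi_im / 2]. *)
Definition jacobi_re : int := (3 * cyc s (1 : F) 1 + 2)%N%:Z - (3 * cyc s 1 (w ^+ 2))%N%:Z.
Definition jacobi_im : int := (3 * cyc s 1 w)%N%:Z - (3 * cyc s 1 (w ^+ 2))%N%:Z.

Lemma jacobi_mod3 : (3 %| - jacobi_re - 1)%Z /\ (3 %| - jacobi_im)%Z.
Proof. by clear cardF w3 w1; rewrite /jacobi_re /jacobi_im; split; lia. Qed.

(** The left side is the trace of the Jacobi sum; the row of class 1 eliminates the two mixed
    cyclotomic numbers. *)
Lemma jacobi_trace : 2 * jacobi_re - jacobi_im = 9 * (cyc s (1 : F) 1)%:Z + 8 - #|F|%:Z.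
Proof.
have := cyc_row (mem_head (1 : F) [:: w; w ^+ 2]); rewrite eqxx /jacobi_re /jacobi_im cardF; lia.
Qed.

(** The target ring is general so as to cover the complex character, its square, and the evaluations
    in [F] itself, where [f] is the identity or squaring. *)
Lemma jacobi_sum (V : comNzRingType) (z : V) (f : F -> V) :
  z ^+ 2 + z + 1 = 0 -> f 0 = 0 -> f 1 = 1 -> f w = z -> f (w ^+ 2) = z ^+ 2 ->
  \sum_t f (t ^+ s) * f ((1 - t) ^+ s) = jacobi_re%:~R + jacobi_im%:~R * z.
Proof.
move=> z0 f0 f1 fw fw2.
rewrite (cyc_sum (h := fun a b => f a * f b)); try by move=> x; rewrite f0 ?mulr0 ?mul0r.
have Ez : z ^+ 2 = - z - 1 by rewrite -[LHS](subr0) -z0; ring.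
rewrite !big_cons !big_nil f1 fw fw2 (cycC w 1) (cycC (w ^+ 2) 1) (cycC (w ^+ 2) w).
rewrite !cyc_ww cyc_w1w2 /jacobi_re /jacobi_im.
have E1 : z * z ^+ 2 = 1 by rewrite Ez mulrBr mulrN -expr2 Ez; ring.
have E2 : z ^+ 2 * z ^+ 2 = z by rewrite -exprD (exprD z 1 3) [z ^+ 3]exprS E1 mulr1.
rewrite (mulrC (z ^+ 2) z) E1 E2 -[z * z]expr2 mulr1 Ez.
move: (cyc s (1 : F) 1) (cyc s 1 w) (cyc s 1 (w ^+ 2)) => A B C.
by rewrite -addn1; ring.
Qed.
End CubicResidues.

(** * The cubic Jacobi sum *)

(* The substitutions [x = u y], then [y = 1 - 1/z], turn the product into
   [\sum_u psi u * \sum_(z != 0, 1) psi ((1 - u) z + u)], whose inner sum runs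
   over an affine line with two points removed. *)
Lemma jacobi_sum_norm (F : finFieldType) (V : fieldType) (psi : F -> V) :
  psi 0 = 0 -> {morph psi : x y / x * y} -> (forall x, x != 0 -> psi x ^+ 3 = 1) ->
  \sum_x psi x = 0 -> \sum_x psi x ^+ 2 = 0 ->
  (\sum_x psi x * psi (1 - x)) * (\sum_x psi x ^+ 2 * psi (1 - x) ^+ 2) = #|F|%:R.
Proof.
move=> psi0 psiM psi3 S1 S2.
have psi1 : psi 1 = 1.
  have p0 : psi 1 != 0.
    by apply: contra_eq_neq (psi3 1 (oner_neq0 _)) => ->; rewrite expr0n eq_sym oner_eq0.
  by apply: (mulfI p0); rewrite -psiM !mulr1.
(* Since cubes of nonzero values are 1, squaring a value inverts it. *)
have psiD (a v : F) : v != 0 -> psi a * psi v ^+ 2 = psi (a / v).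
  move=> v0; transitivity (psi (a / v) * psi v ^+ 3); last by rewrite psi3 ?mulr1.
  by rewrite [in RHS]exprS [RHS]mulrA -psiM mulfVK.
transitivity (\sum_(y | (y != 0) && (y != 1)) \sum_u psi u * psi ((1 - u * y) / (1 - y))).
  rewrite mulr_sumr [RHS]big_mkcond /=; apply: eq_bigr => y _.
  have [->|y0] /= := eqVneq y 0; first by rewrite psi0 expr0n mul0r mulr0.
  have [->|y1] /= := eqVneq y 1; first by rewrite subrr psi0 expr0n !mulr0.
  rewrite mulr_suml (reindex_inj (mulIf y0)) /=; apply: eq_bigr => u _.
  rewrite -psiD ?subr_eq0 1?eq_sym // psiM.
  transitivity (psi u * (psi (1 - u * y) * psi (1 - y) ^+ 2) * psi y ^+ 3); first by ring.
  by rewrite psi3 // mulr1.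
rewrite exchange_big /=.
have T (u : F) : \sum_(y | (y != 0) && (y != 1)) psi u * psi ((1 - u * y) / (1 - y)) =
    psi u * ((if u == 1 then #|F|%:R else 0) - psi u - 1).
  rewrite -mulr_sumr; congr (_ * _).
  have inj : injective (fun z : F => 1 - z^-1) by move=> x y /addrI /oppr_inj /invr_inj.
  rewrite (reindex_inj inj) /=.
  (* For [u = 1] the affine map is constantly 1; otherwise it permutes [F] and the sum of [psi]
     vanishes. *)
  have -> : (if u == 1 then #|F|%:R else 0) = \sum_z psi ((1 - u) * z + u).
    have [->|u1] := eqVneq u 1.
      under eq_bigr => z _ do rewrite subrr mul0r add0r psi1.
      by rewrite sumr_const cardT.
    have u10 : 1 - u != 0 by rewrite subr_eq0 eq_sym.
    by rewrite -[LHS]S1 (reindex_inj (inj_comp (addIr u) (mulfI u10))) /=.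
  (* The removed points [z = 0] and [z = 1] contribute [psi u] and 1. *)
  rewrite [X in _ = X - _ - _](bigD1 0) //= [X in _ = _ + X - _ - _](bigD1 1) //=;
    last exact: oner_neq0.
  rewrite mulr0 add0r mulr1 subrK psi1 [psi u + _]addrC addrK addrAC subrr add0r.
  apply: eq_big => z.
    rewrite subr_eq0 eq_sym -{1}[1]invr1 (inj_eq invr_inj) andbC; congr (_ && _).
    by rewrite -subr_eq0 addrAC subrr add0r oppr_eq0 invr_eq0.
  case/andP => _ z1; congr psi.
  have z0 : z != 0.
    by apply: contra z1 => /eqP ->; rewrite invr0 subr0.
  have -> : 1 - (1 - z^-1) = z^-1 by ring.
  rewrite invrK; field.
  exact: z0.
under eq_bigr => u _ do rewrite T !mulrBr mulr1 -expr2.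
rewrite !sumrB S1 S2 !subr0 (bigD1 1) //= eqxx psi1 mul1r big1 ?addr0 // => u /negPf ->.
by rewrite mulr0.
Qed.

(** * Power sums over a finite field and the reduction of the Jacobi sum *)

Lemma sum_expr_eq0 (F : finFieldType) (m j : nat) :
  #|F| = m.+1 -> ~~ (m %| j)%N -> \sum_(x : F) x ^+ j = 0.
Proof.
move=> cardF mj; have m0 : (0 < m)%N.
  by have := finNzRing_gt1 F; rewrite cardF ltnS.
(* The exponent is reduced modulo [m] so that it is small enough for some [g] to have a nontrivial
   power. *)
have [||g g0 gj] := @ex_expr_neq1 F (j %% m).
- by rewrite lt0n.
- by rewrite cardF ltnS ltn_mod.
have E : \sum_(x : F) x ^+ j = g ^+ (j %% m) * \sum_(x : F) x ^+ j.
  rewrite {1}(reindex_inj (mulfI g0)) mulr_sumr; apply: eq_bigr => x _.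
  rewrite exprMn {1}(divn_eq j m) exprD mulnC exprM.
  by rewrite (expf_card_pred cardF g0) expr1n mul1r.
apply/eqP; have /eqP := E; rewrite -subr_eq0 -{1}[X in X - _]mul1r -mulrBl mulf_eq0.
by rewrite subr_eq0 eq_sym (negPf gj).
Qed.

Lemma sum_expr_card_pred (F : finFieldType) (m : nat) :
  #|F| = m.+1 -> \sum_(x : F) x ^+ m = -1.
Proof.
move=> cardF; have m0 : (0 < m)%N.
  by have := finNzRing_gt1 F; rewrite cardF ltnS.
rewrite (bigD1 0) //= expr0n gtn_eqF // add0r.
rewrite (eq_bigr (fun => 1)) => [|x x0]; last exact: expf_card_pred.
rewrite sumr_const; apply/eqP; rewrite -addr_eq0 -mulrSr -cardsE.
have -> : [set x : F | x != 0] = [set~ 0] by apply/setP=> x; rewrite !inE.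
by rewrite cardsC1 cardF /= -cardF card_natr_eq0.
Qed.

Lemma sum_beta (F : finFieldType) (u v : nat) :
  \sum_(x : F) x ^+ u * (1 - x) ^+ v =
  \sum_(i < v.+1) (-1) ^+ i * 'C(v, i)%:R * \sum_(x : F) x ^+ (u + i).
Proof.
under [RHS]eq_bigr => i _ do rewrite mulr_sumr.
rewrite exchange_big /=; apply: eq_bigr => x _.
rewrite exprDn mulr_sumr; apply: eq_bigr => i _.
by rewrite expr1n mul1r -mulr_natr exprD -[in LHS]mulN1r exprMn; ring.
Qed.

Section JacobiSum.
Variables (F : finFieldType) (s : nat) (w : F).
Hypotheses (cardF : #|F| = (3 * s).+1) (w3 : w ^+ 3 = 1) (w1 : w != 1).

Let s_gt0 : (0 < s)%N := residue_index_gt0 cardF.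

(** The exponents of the power sums run from [s] to [2 * s], hence miss all multiples of [3 * s]. *)
Lemma jacobi_eval : (jacobi_re s w)%:~R + (jacobi_im s w)%:~R * w = 0.
Proof.
have := jacobi_sum cardF w3 w1 (f := id) (cubic_sum0 w3 w1) erefl erefl erefl erefl.
move=> /= <-; rewrite sum_beta big1 // => i _.
rewrite (sum_expr_eq0 cardF) ?mulr0 //.
apply/negP => /dvdn_leq; rewrite addn_gt0 s_gt0 => /(_ isT).
by case: i => i /=; lia.
Qed.

(** Here the exponents run from [2 * s] to [4 * s], and only [3 * s], at [i = s], contributes. *)
Lemma jacobi_eval_conj :
  (jacobi_re s w)%:~R + (jacobi_im s w)%:~R * w ^+ 2 = - 'C(2 * s, s)%:R.
Proof.
have := jacobi_sum cardF w3 w1 (f := fun x => x ^+ 2)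
  (cubic_sqr_sum0 w3 w1) (expr0n _ _) (expr1n _ _) erefl erefl.
move=> /= <-.
under eq_bigr => t _ do rewrite -!exprM mulnC.
rewrite sum_beta.
have sl : (s < (2 * s).+1)%N by lia.
rewrite (bigD1 (Ordinal sl)) //= [X in _ + X]big1 ?addr0 => [|i].

  have -> : (2 * s + s = 3 * s)%N by lia.
  by rewrite (sum_expr_card_pred cardF) (exprN1_residue cardF w3 w1) mul1r mulrN1.
rewrite -val_eqE /= => is_; rewrite (sum_expr_eq0 cardF) ?mulr0 //.
apply: contra is_ => /dvdnP[m Hm]; case: i Hm => i /= il Hm.
have m1 : m = 1%N by nia.
by apply/eqP; move: Hm; rewrite m1; lia.
Qed.

Lemma jacobi_norm : (jacobi_re s w) ^+ 2 - jacobi_re s w * jacobi_im s w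
  + (jacobi_im s w) ^+ 2 = #|F|%:Z.
Proof.
have [z z3 z1] := ex_cubic_root_algC; have zz := cubic_sum0 z3 z1.
(* [f] lifts the cube roots of unity from [F] to the complex numbers, so [psi] is a cubic character
   extended by 0. *)
pose f (a : F) : algC := if a == 1 then 1 else if a == w then z else
  if a == w ^+ 2 then z ^+ 2 else 0.
pose psi (x : F) := f (x ^+ s).
have f0 : f 0 = 0.
  rewrite /f !(eq_sym 0) oner_eq0 (negPf (cubic_neq0 w3)).
  by rewrite expf_eq0 (negPf (cubic_neq0 w3)).
have f1 : f 1 = 1 by rewrite /f eqxx.
have fw : f w = z by rewrite /f (negPf w1) eqxx.
have fw2 : f (w ^+ 2) = z ^+ 2.
  by rewrite /f (negPf (cubic_sqr_neq w3 w1).1) (negPf (cubic_sqr_neq w3 w1).2) eqxx.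
have psi0 : psi 0 = 0 by rewrite /psi (expr0_residue cardF).
have fM (a b : F) : a \in [:: 1; w; w ^+ 2] -> b \in [:: 1; w; w ^+ 2] -> f (a * b) = f a * f b.
  have ww : w * w ^+ 2 = 1 by rewrite -exprS.
  have zz2 : z * z ^+ 2 = 1 by rewrite -exprS.
  have w4 : (w ^+ 2) ^+ 2 = w by rewrite -exprM (exprD w 3 1) w3 mul1r.
  have z4 : (z ^+ 2) ^+ 2 = z by rewrite -exprM (exprD z 3 1) z3 mul1r.
  rewrite !inE => /or3P[] /eqP -> /or3P[] /eqP ->;
    by rewrite ?mul1r ?mulr1 ?[w ^+ 2 * w]mulrC ?ww -?expr2 ?w4
      ?f1 ?fw ?fw2 ?mul1r ?mulr1 ?[z ^+ 2 * z]mulrC ?zz2 -?expr2 ?z4 ?expr1n.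
have psiM : {morph psi : x y / x * y}.
  move=> x y; have [->|x0] := eqVneq x 0; first by rewrite mul0r psi0 mul0r.
  have [->|y0] := eqVneq y 0; first by rewrite mulr0 psi0 mulr0.
  by rewrite /psi exprMn fM // (expr_residue cardF w3 w1).
have psi3 x : x != 0 -> psi x ^+ 3 = 1.
  move/(expr_residue cardF w3 w1); rewrite /psi !inE => /or3P[] /eqP ->.
  - by rewrite f1 expr1n.
  - by rewrite fw.
  - by rewrite fw2 -exprM mulnC exprM z3 expr1n.
(* Multiplication by the non-cube [g] rescales the sums of [psi] and of its square by factors other
   than 1, so both vanish. *)
have [g Hg] : exists g : F, g ^+ s = w.
  have /card_gt0P[g] : (0 < #|[set x : F | x ^+ s == w]|)%N.
    by rewrite (card_residue cardF w3 w1) // !inE eqxx orbT.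
  by rewrite inE => /eqP; exists g.
have g0 : g != 0.
  apply: contra_eq_neq Hg => ->; rewrite (expr0_residue cardF) eq_sym.
  exact: cubic_neq0 w3.
have S (y : algC) (h : F -> algC) : y != 1 -> (forall x, h (g * x) = y * h x) -> \sum_x h x = 0.
  move=> y1 Hh; have E : \sum_x h x = y * \sum_x h x.
    by rewrite {1}(reindex_inj (mulfI g0)) mulr_sumr; apply: eq_bigr => x _.
  apply/eqP; have /eqP := E; rewrite -subr_eq0 -{1}[X in X - _]mul1r -mulrBl mulf_eq0.
  by rewrite subr_eq0 eq_sym (negPf y1).
have psig : psi g = z by rewrite /psi Hg.
have z21 : z ^+ 2 != 1.
  by apply: contra z1 => /eqP E; rewrite -z3 exprS E mulr1.
have := jacobi_sum_norm psi0 psiM psi3 _ _.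
have -> : \sum_x psi x = 0 by apply: (S z) => // x; rewrite psiM psig.
have -> : \sum_x psi x ^+ 2 = 0 by apply: (S (z ^+ 2)) => // x; rewrite psiM psig exprMn.
move=> /(_ erefl erefl).
rewrite (jacobi_sum cardF w3 w1 zz f0 f1 fw fw2).
rewrite (jacobi_sum cardF w3 w1 (z := z ^+ 2) (f := fun a => f a ^+ 2)); first last.
- by rewrite fw2.
- by rewrite fw.
- by rewrite f1 expr1n.
- by rewrite f0 expr0n.
- exact: cubic_sqr_sum0 z3 z1.
move: (jacobi_re s w) (jacobi_im s w) => a b E.
apply/eqP; rewrite -(eqr_int algC) -[X in _ == X]E; apply/eqP.
have Ez : z ^+ 2 = - z - 1 by rewrite -[LHS](subr0) -zz; ring.
rewrite !rmorphD !rmorphN !rmorphM /= Ez.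
transitivity (a%:~R ^+ 2 - a%:~R * b%:~R - b%:~R ^+ 2 * (z ^+ 2 + z) : algC).
  by rewrite Ez; ring.
by ring.
Qed.
End JacobiSum.

(** * The integer kappa *)

(** Modulo [p], [h] is [-1/2], and both sides obey the same first-order recurrence in [n]; the bound
    [n <= h] keeps its denominators invertible. *)
Lemma central_bin_Fp (p h n : nat) : prime p -> p = (2 * h).+1 -> (n <= h)%N ->
  'C(2 * n, n)%:R = (- 4%:R) ^+ n * 'C(h, n)%:R :> 'F_p.
Proof.
move=> p_pr ph; elim: n => [|n IH] nh; first by rewrite !bin0 expr0 mulr1.
have pF := pchar_Fp p_pr.
have n0 : n.+1%:R != 0 :> 'F_p.
  rewrite -(dvdn_pcharf pF); apply/negP => /dvdn_leq => /(_ isT); lia.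
have En : (n.+1 * 'C(2 * n.+1, n.+1) = 2 * (2 * n).+1 * 'C(2 * n, n))%N.
  have D : (n.+1 * 'C((2 * n).+1, n) = (2 * n).+1 * 'C(2 * n, n))%N.
    by have := mul_bin_down (2 * n).+1 n => /= ->; congr (_ * _)%N; lia.
  have -> : (2 * n.+1 = (2 * n).+2)%N by lia.
  have := mul_bin_diag (2 * n).+2 n => /= <-.
  rewrite -(mulnA 2%N) -D; lia.
have hE : 2 * h%:R + 1 = 0 :> 'F_p.
  have := congr1 (fun x => x%:R : 'F_p) ph.
  by rewrite (pchar_Fp_0 p_pr) -[(2 * h).+1]addn1 natrD natrM => <-.
have Eh : n.+1%:R * 'C(h, n.+1)%:R = (h%:R - n%:R) * 'C(h, n)%:R :> 'F_p.
  by rewrite -natrM mul_bin_left natrM natrB 1?ltnW.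
apply: (mulfI n0).
transitivity (- 4%:R * (- 4%:R) ^+ n * ((h%:R - n%:R) * 'C(h, n)%:R) : 'F_p); last first.
  by rewrite -Eh exprS; ring.
rewrite -natrM En natrM IH 1?ltnW //.
move: ((- 4%:R) ^+ n) ('C(h, n)%:R : 'F_p) => X Y.
apply/eqP; rewrite -subr_eq0; apply/eqP.
transitivity (2 * X * Y * (2 * h%:R + 1)); last by rewrite hE mulr0.
by rewrite natrM -[(2 * n).+1]addn1 natrD natrM; ring.
Qed.

(** All base [p] digits of [s] equal [(p - 1) / 3], so doubling [s] produces no carry. Legendre's
    formula expresses this through the quotients by [p ^ i]. *)
Lemma central_bin_ndvd (p k s : nat) : prime p -> (p %% 3 = 1)%N -> (p ^ k)%N = (3 * s).+1 ->
  ~~ (p %| 'C(2 * s, s))%N.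
Proof.
move=> p_pr p3 qs.
have C0 : (0 < 'C(2 * s, s))%N by rewrite bin_gt0; lia.
suff: logn p 'C(2 * s, s) = 0%N.
  move=> L; apply: contraL (isT : true) => pC.
  by have := pfactor_dvdn 1 p_pr C0; rewrite expn1 pC L.
have := bin_fact (_ : s <= 2 * s)%N; rewrite leq_pmull // => /(_ isT).
have -> : (2 * s - s = s)%N by lia.
move/(congr1 (logn p)); rewrite !lognM ?muln_gt0 ?fact_gt0 // !logn_fact //.
rewrite addnn => E.
suff D : (\sum_(1 <= i < (2 * s).+1) (2 * s) %/ p ^ i =
    (\sum_(1 <= i < s.+1) s %/ p ^ i).*2)%N by lia.
(* The added terms vanish because [p ^ i > s] for [i > s]. *)
have -> : (\sum_(1 <= i < s.+1) s %/ p ^ i = \sum_(1 <= i < (2 * s).+1) s %/ p ^ i)%N.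
  have sl : (s.+1 <= (2 * s).+1)%N by lia.
  rewrite [RHS](big_cat_nat (n := s.+1)) //= [X in (_ + X)%N]big_nat [X in (_ + X)%N]big1 ?addn0 //
    => i /andP[si _].
  by rewrite divn_small // (leq_trans si) // ltnW // ltn_expl // prime_gt1.
rewrite -mul2n big_distrr /=; apply: eq_bigr => i _.
have pow3 j : exists v, (p ^ j = (3 * v).+1)%N.
  exists (p ^ j %/ 3)%N; have := divn_eq (p ^ j) 3; rewrite -modnXm p3 exp1n; lia.
have [v Hv] := pow3 i; case: (leqP i k) => ik; last first.
  have : (p ^ k < p ^ i)%N by rewrite ltn_exp2l // prime_gt1.
  rewrite qs => lt; rewrite !divn_small //; lia.
have [y Hy] := pow3 (k - i)%N.
have sE : (s = y * p ^ i + v)%N.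
  have : (p ^ k = p ^ i * p ^ (k - i))%N by rewrite -expnD subnKC.
  by rewrite qs Hy Hv; nia.
have p0 : (0 < p ^ i)%N by rewrite Hv.
have -> : (s %/ p ^ i = y)%N.
  by rewrite {1}sE divnMDl // divn_small ?addn0 // Hv; lia.
have -> : (2 * s = (2 * y) * p ^ i + 2 * v)%N by rewrite {1}sE mulnDr mulnA.
by rewrite divnMDl // divn_small ?addn0 // Hv; lia.
Qed.

Lemma kappa_okP (p : nat) (z : int) : kappa_ok p z =
  (z ^+ 2 <= 4 * p%:Z) && ((z%:~R : 'F_p) ==
        - ('C((p.-1)./2, (p.-1) %/ 3))%:R / (4%:R ^+ ((p.-1) %/ 6))).
Proof.
rewrite /kappa_ok; congr (_ && _).
have p0 : 0 <= 2 * sqrtC p%:R :> algC by rewrite mulr_ge0 ?sqrtC_ge0 ?ler0n.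
rewrite -ler_sqr ?nnegrE ?normr_ge0 // exprMn sqrtCK -normrX ger0_norm; last first.
  by rewrite -rmorphXn /= ler0z sqr_ge0.
by rewrite -rmorphXn /= -natrX -natrM -(ler_int algC) -pmulrn.
Qed.

(** The difference is at most [4 * sqrt p], which is below [p] once [p > 16]; 7 and 13 need separate
    treatment. *)
Lemma eqz_of_small_sqr (p : nat) (x y : int) : (16 < p)%N ->
  x ^+ 2 <= 4 * p%:Z -> y ^+ 2 <= 4 * p%:Z -> (p %| x - y)%Z -> x = y.
Proof.
move=> p16 xp yp /dvdzP[m Hm].
have E : (x - y) ^+ 2 <= 16 * p%:Z.
  have := sqr_ge0 (x + y).
  have -> : (x + y) ^+ 2 = 2 * x ^+ 2 + 2 * y ^+ 2 - (x - y) ^+ 2 by ring.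
  move: xp yp; move: (x ^+ 2) (y ^+ 2) ((x - y) ^+ 2) => a b c; lia.
have m0 : m = 0.
  apply/eqP; rewrite -sqrf_eq0; apply/eqP.
  move: E (sqr_ge0 m); rewrite Hm exprMn; move: (m ^+ 2) => u.
  by rewrite expr2; nia.
by apply/eqP; rewrite -subr_eq0 Hm m0 mul0r.
Qed.

Lemma kappa_eq (p : nat) (z : int) : prime p -> (p %% 3 = 1)%N ->
  kappa_ok p z -> kappa p = z.
Proof.
move=> p_pr p3 zok.
have Fp0 (x : int) : (p %| x)%Z = ((x%:~R : 'F_p) == 0).
  by rewrite (dvdz_pcharf (pchar_Fp p_pr)).
rewrite /kappa p3 /=; case: eqP => [p7|p7].
  subst p; move: zok; rewrite kappa_okP => /andP[zs /eqP zE].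
  (* The prescribed residue is [- 'C(3, 2) / 4]. *)
  have /dvdzP[m Hm] : (7%N %| 4 * z + 3)%Z.
    by rewrite Fp0 rmorphD rmorphM /= zE; vm_compute.
  have /andP[z5 z5'] : -5 <= z <= 5 by nia.
  lia.
case: eqP => [p13|p13].
  subst p; move: zok; rewrite kappa_okP => /andP[zs /eqP zE].
  (* The prescribed residue is [- 'C(6, 4) / 4 ^ 2]. *)
  have /dvdzP[m Hm] : (13%N %| 16 * z + 15)%Z.
    by rewrite Fp0 rmorphD rmorphM /= zE; vm_compute.
  have /andP[z7 z7'] : -7 <= z <= 7 by nia.
  lia.
have p16 : (16 < p)%N.
  rewrite ltnNge; apply/negP; case: p p_pr p3 p7 p13 {zok Fp0} => //.
  by do 16!case=> //.
rewrite /kappa_search; set L := map _ _.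
have zL : z \in L.
  have zs : z ^+ 2 <= 4 * p%:Z by move: zok; rewrite kappa_okP => /andP[].
  have /andP[zl zr] : - (2 * p)%:Z <= z <= (2 * p)%:Z.
    rewrite -ler_norml -ler_sqr ?nnegrE ?normr_ge0 // -normrX ger0_norm ?sqr_ge0 //.
    by apply: le_trans zs _; nia.
  apply/mapP; exists (absz (z + (2 * p)%:Z)); last by lia.
  by rewrite mem_iota; lia.
have : z \in [seq z <- L | kappa_ok p z] by rewrite mem_filter zok.
have : all (fun x => x == z) [seq z <- L | kappa_ok p z].
  apply/allP => x; rewrite mem_filter => /andP[xok _]; apply/eqP.
  move: xok zok; rewrite !kappa_okP => /andP[xs /eqP xE] /andP[zs /eqP zE].
  by apply: (eqz_of_small_sqr p16 xs zs); rewrite Fp0 rmorphB /= xE zE subrr.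
by case: [seq z <- L | kappa_ok p z] => //= x l /andP[/eqP].
Qed.

(** The bound makes the radicand nonnegative, so the square root is real and conjugation only flips
    the sign of the imaginary part. *)
Lemma pi_p_sum (p : nat) : (kappa p) ^+ 2 <= 4 * p%:Z ->
  pi_p p + (pi_p p)^* = - (kappa p)%:~R /\ pi_p p * (pi_p p)^* = p%:R.
Proof.
move=> kp; rewrite /pi_p; set u := sqrtC _.
have u0 : 0 <= u.
  rewrite sqrtC_ge0 subr_ge0 ler_pdivrMr ?ltr0n //.
  by move: kp; rewrite -(ler_int algC) rmorphXn rmorphM /= mulrC.
have uE : u ^+ 2 = p%:R - (kappa p)%:~R ^+ 2 / 4%:R by rewrite sqrtCK.
have -> : (- (kappa p)%:~R / 2%:R + 'i * u)^* = - (kappa p)%:~R / 2%:R - 'i * u.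
  rewrite rmorphD !rmorphM /= conjCi (geC0_conj u0) fmorphV rmorphN /=.
  by rewrite rmorph_int rmorph_nat; ring.
split; first by field.
transitivity ((kappa p)%:~R ^+ 2 / 4%:R - 'i ^+ 2 * u ^+ 2); first by field.
by rewrite sqrCi uE; field.
Qed.

(** Equal sum and product mean equal unordered pairs. This avoids deciding which of two conjugates
    [pi_p] is. *)
Lemma power_sum_pair (R : idomainType) (x x' y y' : R) (k : nat) :
  x + x' = y + y' -> x * x' = y * y' -> x ^+ k + x' ^+ k = y ^+ k + y' ^+ k.
Proof.
move=> S P; have : (x - y) * (x - y') = 0.
  transitivity (x ^+ 2 - (y + y') * x + y * y'); first by ring.
  by rewrite -S -P; ring.
move/eqP; rewrite mulf_eq0 !subr_eq0 => /orP[] /eqP E.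
  by move: S; rewrite E => /addrI ->.
by move: S; rewrite E addrC => /addIr ->; rewrite addrC.
Qed.

(** * Comparison of Jacobi sums with [kappa] and [pi_p] *)

Lemma ex_cubic_root (F : finFieldType) (s : nat) : #|F| = (3 * s).+1 ->
  exists2 w : F, w ^+ 3 = 1 & w != 1.
Proof.
move=> cardF; have s0 := residue_index_gt0 cardF.
have [|x x0 xs] := ex_expr_neq1 (F := F) s0; first by rewrite cardF; lia.
by exists (x ^+ s) => //; rewrite -exprM mulnC (expf_card_pred cardF).
Qed.

Lemma jacobi_prime_kappa (p s : nat) (w : 'F_p) : prime p -> (p %% 3 = 1)%N ->
  p = (3 * s).+1 -> w ^+ 3 = 1 -> w != 1 ->
  kappa p = 2 * jacobi_re s w - jacobi_im s w.
Proof.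
move=> p_pr p3 ps w3 w1.
have cardF : #|'F_p| = (3 * s).+1 by rewrite card_Fp.
have Nrm := jacobi_norm cardF w3 w1; rewrite card_Fp // in Nrm.
have E1 := jacobi_eval cardF w3 w1; have E2 := jacobi_eval_conj cardF w3 w1.
have w0 := cubic_sum0 w3 w1.
apply: kappa_eq => //; rewrite kappa_okP; apply/andP; split.
  rewrite -{}Nrm -subr_ge0; set c := jacobi_re s w; set d := jacobi_im s w.
  have -> : 4 * (c ^+ 2 - c * d + d ^+ 2) - (2 * c - d) ^+ 2 = 3 * d ^+ 2 by ring.
  by rewrite mulr_ge0 ?sqr_ge0.
(* The trace is the sum of the evaluations at [w] and [w ^+ 2], the first of which is 0. *)
have -> : (2 * jacobi_re s w - jacobi_im s w)%:~R = - 'C(2 * s, s)%:R :> 'F_p.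
  rewrite -E2 -[RHS]add0r -{1}E1.
  transitivity ((jacobi_re s w)%:~R * 2 + (jacobi_im s w)%:~R * (w ^+ 2 + w + 1)
    - (jacobi_im s w)%:~R : 'F_p).
    by rewrite w0 mulr0 addr0 rmorphB rmorphM /= mulrC.
  by ring.
have [m sm] : exists m, s = (2 * m)%N.
  case: (even_prime p_pr) => [p2|po]; first by move: p3; rewrite p2.
  exists s./2; move: po; rewrite {1}ps /=; lia.
have ph : p = (2 * (3 * m)).+1 by lia.
have -> : (p.-1)./2 = (3 * m)%N by lia.
have -> : (p.-1 %/ 3)%N = s by lia.
have -> : (p.-1 %/ 6)%N = m by lia.
rewrite (central_bin_Fp p_pr ph) ?mulNr; last by lia.
rewrite mulrC -mulNr -mulNr; apply/eqP; congr (_ * _).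
have four : 4%:R != 0 :> 'F_p.
  rewrite -(dvdn_pcharf (pchar_Fp p_pr)); apply/negP => /dvdn_leq => /(_ isT).
  by case: p p_pr p3 {w w3 w1 cardF Nrm E1 E2 w0 ps ph} => [|[|[|[|[|]]]]].
(* It remains that [16 ^ m] inverts [4 ^ m]: their product is 2 to the power [6 * m = p - 1]. *)
apply: (mulIf (expf_neq0 m four)); rewrite mulVf ?expf_neq0 //.
have two : 2%:R != 0 :> 'F_p by apply: contra four => /eqP E; rewrite (natrM _ 2 2) E mul0r.
have p6 : p.-1 = (4 * m + 2 * m)%N by rewrite ph /=; lia.
have E4 : 4%:R ^+ m = 2%:R ^+ (2 * m) :> 'F_p.
  by rewrite exprM expr2 -natrM.
have E16 : (- 4%:R) ^+ (2 * m) = 2%:R ^+ (4 * m) :> 'F_p.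
  by rewrite !exprM sqrrN (natrM _ 2 2); congr (_ ^+ m); ring.
rewrite sm E16 E4 -exprD -p6; apply: expf_card_pred two.
by rewrite card_Fp // prednK // prime_gt0.
Qed.

(** In [F], [- (1 + r)] is the square of the cube root [r], so the expression reduces to
    ['C(2 * s, s)]. *)
Lemma jacobi_ndvd (p k s r : nat) (F : finFieldType) : p \in [pchar F] ->
  (p %% 3 = 1)%N -> #|F| = (p ^ k)%N -> (p ^ k)%N = (3 * s).+1 ->
  (r%:R : F) ^+ 3 = 1 -> (r%:R : F) != 1 ->
  ~~ (p %| - jacobi_re s (r%:R : F) - - jacobi_im s (r%:R : F) * (1 + r%:Z))%Z.
Proof.
move=> pF p3 cardFp qs w3 w1; have cardF : #|F| = (3 * s).+1 by rewrite cardFp.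
have := central_bin_ndvd (pcharf_prime pF) p3 qs.
rewrite (dvdn_pcharf pF) (dvdz_pcharf pF) -oppr_eq0 -(jacobi_eval_conj cardF w3 w1).
move: (jacobi_re _ _) (jacobi_im _ _) => a b; rewrite -[X in ~~ X -> _]oppr_eq0.
set x := (X in X == 0); set y := (X in _ -> ~~ (X == 0)); suff -> : x = y by [].
rewrite /x /y !rmorphD !rmorphN !rmorphM !rmorphN !rmorphD /= rmorph1 -pmulrn.
have -> : r%:R ^+ 2 = - r%:R - 1 :> F.
  by rewrite -[LHS]subr0 -(cubic_sum0 w3 w1); ring.
by ring.
Qed.

Lemma cyc11_pi_p (p k s : nat) (F : finFieldType) : prime p -> #|F| = (p ^ k)%N ->
  (p ^ k)%N = (3 * s).+1 ->
  9 * (cyc s (1 : F) 1)%:R + 8 - (p ^ k)%:R = - (pi_p p ^+ k + (pi_p p)^* ^+ k) :> algC.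
Proof.
move=> p_pr cardFp qs.
have cardF : #|F| = (3 * s).+1 by rewrite cardFp.
suff [w w3 [w1 E]] : exists2 w : F, w ^+ 3 = 1 & w != 1 /\
    (2 * jacobi_re s w - jacobi_im s w)%:~R = - (pi_p p ^+ k + (pi_p p)^* ^+ k).
  by rewrite -E (jacobi_trace cardF w3 w1) cardFp rmorphB rmorphD rmorphM.
have p3 : (p %% 3 = 1)%N \/ (p %% 3 = 2)%N.
  have : (p %% 3 < 3)%N by rewrite ltn_mod.
  have : (p %% 3 != 0)%N.
    apply/eqP => p3; have := modnXm k 3 p; rewrite p3 qs.
    case: (k) qs => [|k'] qs; last by rewrite exp0n //; lia.
    by move: qs; rewrite expn0; have := residue_index_gt0 cardF; lia.
  by case: (p %% 3)%N => [|[|[|]]] //; [left|right].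
have pF : p \in [pchar F].
  rewrite inE p_pr /=.
  have : (p ^ k)%:R = 0 :> F by rewrite -cardFp card_natr_eq0.
  by rewrite natrX => /eqP; rewrite expf_eq0 => /andP[].
case: p3 => p3; last first.
  have [w w3 w1] := ex_cubic_root cardF; exists w => //; split => //.
  (* [p ^ k] is 1 modulo 3 while [p] is -1, which forces [k] to be even. *)
  have [m km] : exists m, k = (2 * m)%N.
    exists k./2; have := odd_double_half k; case: odd => /=; last by lia.
    rewrite add1n => kE; have := modnXm k 3 p; rewrite p3 qs -kE expnS -mul2n expnM.
    have : ((2 ^ 2) ^ k./2 %% 3 = 1)%N by rewrite -modnXm exp1n.
    move: ((2 ^ 2) ^ k./2)%N => u; clear; lia.
  have [d1 d2] := jacobi_mod3 s w.
  have Nrm := jacobi_norm cardF w3 w1.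
  have [] := inert_descent (m := m) p_pr p3 _ d1 d2.
    by rewrite !sqrrN mulrNN Nrm cardFp km.
  move=> /eqP; rewrite eqr_oppLR => /eqP aE /eqP; rewrite oppr_eq0 => /eqP bE.
  (* Then the conjugate of [pi_p p] is its opposite, and its square is [- p]. *)
  have k0 : kappa p = 0 by rewrite /kappa p3; case: eqP p3 => [->|_] //; case: eqP => [->|].
  have [] := @pi_p_sum p; first by rewrite k0; lia.
  rewrite k0 oppr0 addrC => /eqP; rewrite addr_eq0 => /eqP pc.
  rewrite pc mulrN => /eqP; rewrite eqr_oppLR -expr2 => /eqP p2.
  rewrite km !exprM sqrrN p2 aE bE subr0 rmorphM rmorphN rmorphXn rmorphN /=.
  by rewrite -pmulrn; ring.
have [s' ps'] : exists s', p = (3 * s').+1.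
  by exists (p %/ 3)%N; have := divn_eq p 3; rewrite p3; lia.
have cardFp' : #|'F_p| = (3 * s').+1 by rewrite card_Fp.
have [v v3 v1] := ex_cubic_root cardFp'.
(* One integer [r] represents the cube root of unity in both ['F_p] and [F], so that both Jacobi
   sums avoid the same prime above [p]. *)
pose r : nat := v.
have rv : r%:R = v by exact: natr_Zp.
pose w : F := r%:R.
have r0 : (p %| r%:Z ^+ 2 + r%:Z + 1)%Z.
  rewrite (dvdz_pcharf (pchar_Fp p_pr)) !rmorphD rmorphXn /= -pmulrn rv.
  by rewrite (cubic_sum0 v3 v1).
have w0 : w ^+ 2 + w + 1 = 0.
  by apply/eqP; move: r0; rewrite (dvdz_pcharf pF) !rmorphD rmorphXn /= -pmulrn.
have w3 : w ^+ 3 = 1.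
  by apply/eqP; rewrite -subr_eq0 -[X in _ == X](mulr0 (w - 1)) -w0; apply/eqP; ring.
have w1 : w != 1.
  apply: contraTneq (three_neq0 cardF) => E; move: w0; rewrite E expr1n => E3.
  by rewrite negbK; apply/eqP; rewrite -E3; ring.
exists w => //; split => //.
have [d1 d2] := jacobi_mod3 s w; have [d1' d2'] := jacobi_mod3 s' v.
have Nrm := jacobi_norm cardF w3 w1; have := jacobi_norm cardFp' v3 v1.
rewrite card_Fp // => Nrm'.
have nd := jacobi_ndvd pF p3 cardFp qs w3 w1.
have nd' : ~~ (p %| - jacobi_re s' v - - jacobi_im s' v * (1 + r%:Z))%Z.
  have := @jacobi_ndvd p 1 s' r _ (pchar_Fp p_pr) p3; rewrite rv; apply => //.
  by rewrite card_Fp.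
have desc := eisenstein_descent p_pr r0 _ d1' d2' nd' _ d1 d2 nd.
have kap := jacobi_prime_kappa p_pr p3 ps' v3 v1.
have [z z3 z1] := ex_cubic_root_algC.
have zz := cubic_sum0 z3 z1; have zz2 := cubic_sqr_sum0 z3 z1.
have Ez : z ^+ 2 = - z - 1 by rewrite -[LHS](subr0) -zz; ring.
have kp4 : (kappa p) ^+ 2 <= 4 * p%:Z.
  rewrite kap -Nrm' -subr_ge0; set c := jacobi_re _ _; set d := jacobi_im _ _.
  have -> : 4 * (c ^+ 2 - c * d + d ^+ 2) - (2 * c - d) ^+ 2 = 3 * d ^+ 2 by ring.
  by rewrite mulr_ge0 ?sqr_ge0.
have [pS pP] := pi_p_sum kp4.
rewrite kap in pS; rewrite -[p%:R]/(p%:Z%:~R) -Nrm' in pP.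
move: desc pS pP; rewrite !sqrrN !mulrNN => /(_ k Nrm').
rewrite Nrm cardFp => /(_ erefl) desc.
move: (jacobi_re s' v) (jacobi_im s' v) desc => c d desc pS pP.
(* The new pair is the negated Jacobi sum over ['F_p] and its conjugate. *)
rewrite (power_sum_pair (y := (- c)%:~R + (- d)%:~R * z) (y' := (- c)%:~R + (- d)%:~R * z ^+ 2)).
- rewrite -!desc //; move: (jacobi_re s w) (jacobi_im s w) => a b.
  by rewrite Ez !rmorphD !rmorphN !rmorphM /=; ring.
- by rewrite pS Ez !rmorphD !rmorphN !rmorphM /=; ring.
rewrite pP !rmorphD !rmorphN !rmorphM /=.
transitivity (c%:~R * c%:~R + c%:~R * d%:~R * (z ^+ 2 + z) + d%:~R * d%:~R * z ^+ 3 : algC).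
  by rewrite z3 Ez; ring.
by ring.
Qed.

(** * Counting the permutation polynomials *)

Section PermutationCount.
Variables (F : finFieldType) (s : nat) (w : F) (n : nat).
Hypotheses (cardF : #|F| = (3 * s).+1) (w3 : w ^+ 3 = 1) (w1 : w != 1).
Hypotheses (n_gt0 : (0 < n)%N) (n_s : coprime n s).

Let s_gt0 : (0 < s)%N := residue_index_gt0 cardF.
Let w0 : w != 0 := cubic_neq0 w3.

(** Raising a value at [x] to the power [s] gives [g (x ^+ s)], so the map on cubic classes must be
    a bijection. The head [0] excludes a vanishing value; inside a class, coprimality of [n] and [s]
    gives injectivity. *)
Lemma permpoly_uniq (a : F) : is_permpoly ('X^n * ('X^s + a%:P)) =
  uniq (0 :: [seq y ^+ n * (y + a) ^+ s | y <- [:: 1; w; w ^+ 2]]).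
Proof.
set g := fun y => y ^+ n * (y + a) ^+ s.
pose f (x : F) := x ^+ n * (x ^+ s + a).
have fE x : ('X^n * ('X^s + a%:P)).[x] = f x by rewrite !hornerE.
have fg x : f x ^+ s = g (x ^+ s) by rewrite /f /g exprMn -!exprM mulnC.
have f0 : f 0 = 0 by rewrite /f expr0n gtn_eqF // mul0r.
have -> : is_permpoly ('X^n * ('X^s + a%:P)) = injectiveb f.
  by apply/injectiveP/injectiveP => inj x y; have := inj x y; rewrite !fE.
apply/injectiveP/idP => [inj|].
  have sub : {subset [:: 1; w; w ^+ 2] <= map g [:: 1; w; w ^+ 2]}.
    move=> c cP; have /card_gt0P[z] : (0 < #|[set x : F | x ^+ s == c]|)%N.
      by rewrite (card_residue cardF w3 w1 cP).
    rewrite inE => /eqP zc; rewrite -zc -(f_invF inj z) fg; apply: map_f.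
    apply: (expr_residue cardF w3 w1); apply: contraTneq cP => E.
    have := f_invF inj z; rewrite E f0 => z0.
    by rewrite -zc -z0 (expr0_residue cardF) (cubic_mem w3 w1) expr0n eq_sym oner_eq0.
  have [_ eq_mem] := uniq_min_size (uniq_cubic w3 w1) sub (leqnn _).
  rewrite cons_uniq (leq_size_uniq (uniq_cubic w3 w1) sub (leqnn _)) andbT.
  by rewrite -eq_mem (cubic_mem w3 w1) expr0n eq_sym oner_eq0.
rewrite cons_uniq => /andP[g0 gU].
have g_inj y z : y \in [:: 1; w; w ^+ 2] -> z \in [:: 1; w; w ^+ 2] -> g y = g z -> y = z.
  rewrite !inE => /or3P[] /eqP -> /or3P[] /eqP -> E //;
    by move: gU; rewrite /= !inE E eqxx ?orbT ?andbF.
have f_eq0 x : f x = 0 -> x = 0.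
  move=> fx; apply: contraNeq g0 => x0.
  have <- : g (x ^+ s) = 0 by rewrite -fg fx (expr0_residue cardF).
  by apply/map_f/(expr_residue cardF w3 w1).
move=> x y fxy; have [x0|x0] := eqVneq x 0.
  by apply/esym; rewrite x0; apply: f_eq0; rewrite -fxy x0.
have [y0|y0] := eqVneq y 0; first by rewrite y0; apply: f_eq0; rewrite fxy y0.
have xy_s : x ^+ s = y ^+ s.
  by apply: g_inj; rewrite ?(expr_residue cardF w3 w1) // -!fg fxy.
have xy_n : x ^+ n = y ^+ n.
  have y_n0 : y ^+ s + a != 0.
    by apply: contra y0 => /eqP E; apply/eqP/f_eq0; rewrite /f E mulr0.
  by apply: (mulIf y_n0); move: fxy; rewrite /f xy_s.
(* Bezout gives [u * n = v * s + 1], and the powers [n] and [s] of [x] and [y] agree. *)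
case: (egcdnP s n_gt0) => u v E _; rewrite (eqP n_s) addn1 in E.
have : x ^+ (u * n) = y ^+ (u * n) by rewrite mulnC !exprM xy_n.
rewrite E !exprSr mulnC !exprM xy_s; apply: mulfI.
by rewrite !expf_neq0.
Qed.

Lemma card_cyc_sqr (x : F) : x \in [:: 1; w; w ^+ 2] ->
  cyc s x (x ^+ 2) = (cyc s (1 : F) 1 + (x != 1%R))%N.
Proof.
have w4 : (w ^+ 2) ^+ 2 = w by rewrite -exprM (exprD w 3 1) w3 mul1r.
rewrite !inE => /or3P[] /eqP ->.
- by rewrite expr1n eqxx addn0.
- by rewrite (cyc_w1w2 cardF w3 w1) w1 addn1.
- by rewrite w4 cycC (cyc_w1w2 cardF w3 w1) (cubic_sqr_neq w3 w1).1 addn1.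
Qed.

(* Up to the factor [(1 + a)^s] and powers of [w], the values of
   [y^n (y + a)^s] at [1, w, w^2] are [1, t^s, (1 - t)^s]. *)
Lemma permpoly_moebius (a : F) (d := w ^+ (2 * n + s)) (t := - (w * (w + a) / (1 + a))) :
  1 + a != 0 -> is_permpoly ('X^n * ('X^s + a%:P)) =
  ((t ^+ s == d * w) && ((1 - t) ^+ s == (d * w) ^+ 2))
  || ((t ^+ s == d * w ^+ 2) && ((1 - t) ^+ s == (d * w ^+ 2) ^+ 2)).
Proof.
move=> a1; rewrite permpoly_uniq.
set P := (1 + a) ^+ s; have P0 : P != 0 by rewrite expf_neq0.
have wk k : w ^+ k != 0 by rewrite expf_neq0.
have N1 := exprN1_residue cardF w3 w1.
pose c := w ^+ (n + 2 * s).
have cd : c * d = 1.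
  by rewrite -exprD (_ : _ + _ = 3 * (n + s))%N ?exprM ?w3 ?expr1n //; lia.
have E1 : w ^+ n * (w + a) ^+ s = P * (c * t ^+ s).
  rewrite /t -mulN1r !exprMn N1 mul1r exprVn -/P /c exprD mulnC exprM.
  transitivity (w ^+ n * (w + a) ^+ s * w ^+ (3 * s)); first by rewrite exprM w3 expr1n mulr1.
  have -> : w ^+ (3 * s) = (w ^+ s) ^+ 2 * w ^+ s by rewrite -exprSr -exprM mulnC.
  by field.
have E2 : (w ^+ 2) ^+ n * (w ^+ 2 + a) ^+ s = P * (c ^+ 2 * (1 - t) ^+ s).
  have -> : 1 - t = -1 * (w ^+ 2 * (w ^+ 2 + a) / (1 + a)).
    have -> : 1 - t = (1 + a + w * (w + a)) / (1 + a) by rewrite /t; field.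
    rewrite mulN1r -mulNr; congr (_ / _); apply/eqP; rewrite -subr_eq0; apply/eqP.
    transitivity ((w ^+ 2 + w + 1) * (1 + a) + w * (w ^+ 3 - 1)); first by ring.
    by rewrite (cubic_sum0 w3 w1) w3 subrr mul0r mulr0 addr0.
  rewrite !exprMn N1 mul1r exprVn -/P /c exprD.
  transitivity (w ^+ n * w ^+ n * (w ^+ 2 + a) ^+ s * w ^+ (3 * (2 * s))).
    by rewrite exprM w3 expr1n mulr1.
  have -> : w ^+ (3 * (2 * s)) = (w ^+ (2 * s)) ^+ 2 * (w ^+ s * w ^+ s).
    by rewrite -exprM -!exprD; congr (_ ^+ _); lia.
  by field.
(* Both normalised values are 0 or cube roots of unity, leaving sixteen cases; with 0 and 1 they are
   distinct only for [(w, w ^+ 2)] and [(w ^+ 2, w)]. *)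
have mem0 (x : F) k : w ^+ k * x ^+ s \in [:: 0, 1, w & [:: w ^+ 2]].
  have [->|x0] := eqVneq x 0; first by rewrite (expr0_residue cardF) mulr0 mem_head.
  rewrite in_cons (cubic_mem w3 w1) exprMn -!exprM [(k * 3)%N]mulnC exprM w3 expr1n mul1r.
  by rewrite mulnC (expf_card_pred cardF x0) eqxx orbT.
have c0 : c != 0 by apply: wk.
have xP (x : F) : (P * x == P) = (x == 1) by rewrite -{2}[P]mulr1 (inj_eq (mulfI P0)).
have dE (x y : F) : (x == d * y) = (c * x == y).
  by rewrite -(inj_eq (mulfI c0)) mulrA cd mul1r.
have dE2 (x y : F) : (x == (d * y) ^+ 2) = (c ^+ 2 * x == y ^+ 2).
  by rewrite -(inj_eq (mulfI (expf_neq0 2 c0))) -exprMn mulrA cd mul1r.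
have := mem0 t (n + 2 * s)%N; have := mem0 (1 - t) ((n + 2 * s) * 2)%N.
rewrite exprM -/c !dE !dE2 /= !inE expr1n mul1r -/P E1 E2.
move: (c * t ^+ s) (c ^+ 2 * (1 - t) ^+ s) => x y.
rewrite !(eq_sym 0) !mulf_eq0 (negPf P0) !(eq_sym P) !xP !(inj_eq (mulfI P0)) /=.
have w4 : (w ^+ 2) ^+ 2 = w by rewrite -exprM (exprD w 3 1) w3 mul1r.
have [n1 n2] := cubic_sqr_neq w3 w1.
have o0 : 1 != 0 :> F := oner_neq0 _.
have w20 : w ^+ 2 != 0 by [].
have [n3 n4 n5] : [/\ 0 != w, 0 != w ^+ 2 & w != w ^+ 2] by rewrite !(eq_sym 0) (eq_sym w).
have [n6 n7 n8] : [/\ 1 != w, 1 != w ^+ 2 & 0 != 1 :> F] by rewrite !(eq_sym 1) (eq_sym 0).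
rewrite w4; by case/or4P=> /eqP -> /or4P[] /eqP ->; rewrite ?eqxx
  ?(negPf n1) ?(negPf n2) ?(negPf n3) ?(negPf n4) ?(negPf n5) ?(negPf n6) ?(negPf n7)
  ?(negPf n8) ?(negPf w0) ?(negPf w1) ?(negPf w20) ?(negPf o0).
Qed.

Lemma expr_cubic_eq (i j : nat) : (w ^+ i == w ^+ j) = (i == j %[mod 3]).
Proof.
rewrite -(expr_mod i w3) -(expr_mod j w3).
have := ltn_pmod i (isT : (0 < 3)%N); have := ltn_pmod j (isT : (0 < 3)%N).
have [n1 n2] := cubic_sqr_neq w3 w1.
case: (i %% 3)%N => [|[|[|]]] //; case: (j %% 3)%N => [|[|[|]]] // _ _;
  by rewrite ?eqxx // ?expr0 ?expr1 ?(negPf n1) ?(negPf n2) ?(negPf w1) //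
    eq_sym ?(negPf n1) ?(negPf n2) ?(negPf w1).
Qed.

Lemma card_permpoly : #|[set a : F | is_permpoly ('X^n * ('X^s + a%:P))]| =
  (2 * cyc s (1 : F) 1 + (s == n %[mod 3]) + (3 %| n))%N.
Proof.
pose d := w ^+ (2 * n + s).
pose Q (e t : F) := (t ^+ s == e) && ((1 - t) ^+ s == e ^+ 2).
(* The pole [a = -1] is sent to [- w], the value at infinity and the only one missed, which makes
   [h] a permutation of [F]. *)
pose h (a : F) := if a == -1 then - w else - (w * (w + a) / (1 + a)).
have a1P (a : F) : (1 + a != 0) = (a != -1) by rewrite addrC addr_eq0.
have hw (a : F) : (h a == - w) = (a == -1).
  rewrite /h; have [_|a1] := eqVneq a (-1); first by rewrite eqxx.
  rewrite -a1P in a1; rewrite eqr_opp -subr_eq0.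
  have -> : w * (w + a) / (1 + a) - w = w * (w - 1) / (1 + a) by field.
  by rewrite !mulf_eq0 invr_eq0 subr_eq0 (negPf w0) (negPf w1) (negPf a1).
have h_inj : injective h.
  move=> a b E; have [a1|a1] := eqVneq a (-1).
    by apply/eqP; rewrite a1 eq_sym -hw -E hw a1.
  have b1 : b != -1 by rewrite -hw -E hw.
  move: E; rewrite /h (negPf a1) (negPf b1) => /oppr_inj.
  rewrite -a1P in a1; rewrite -a1P in b1 => E.
  have /eqP : w * ((w - 1) * (b - a)) = 0.
    transitivity ((w * (w + a) / (1 + a) - w * (w + b) / (1 + b)) * ((1 + a) * (1 + b))).
      by field; rewrite a1 b1.
    by rewrite E subrr mul0r.
  by rewrite !mulf_eq0 !subr_eq0 (negPf w0) (negPf w1) eq_sym => /eqP.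
have Qw (e : F) : Q e (- w) = (w ^+ s == e).
  have N1 := exprN1_residue cardF w3 w1.
  have -> : Q e (- w) = (w ^+ s == e) && ((w ^+ s) ^+ 2 == e ^+ 2).
    rewrite /Q opprK; have -> : 1 + w = -1 * w ^+ 2.
      apply/eqP; rewrite mulN1r -addr_eq0; apply/eqP.
      by rewrite -[RHS](cubic_sum0 w3 w1); ring.
    by rewrite exprMn N1 mul1r -mulN1r exprMn N1 mul1r -!exprM mulnC.
  by case: eqP => // ->; rewrite eqxx.
have -> : #|[set a : F | is_permpoly ('X^n * ('X^s + a%:P))]| =
    #|[set t : F | (t != - w) && (Q (d * w) t || Q (d * w ^+ 2) t)]|.
  rewrite -!sum1_card [RHS](reindex_inj h_inj); apply: eq_bigl => a.
  rewrite !inE hw; have [->|a1] /= := eqVneq a (-1).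
    rewrite permpoly_uniq; apply/negP; rewrite /= !inE.
    by rewrite subrr (expr0_residue cardF) mulr0 eqxx.
  by rewrite permpoly_moebius ?a1P // /Q /h (negPf a1).
have dE k : d * w ^+ k = w ^+ (2 * n + s + k) by rewrite -exprD.
have dis (t : F) : ~~ (Q (d * w) t && Q (d * w ^+ 2) t).
  apply/negP; rewrite /Q => /andP[/andP[/eqP -> _] /andP[+ _]].
  by rewrite -{1}[w]expr1 !dE expr_cubic_eq; lia.
have cycQ (e : F) : cyc s e (e ^+ 2) = (Q e (- w) + \sum_(t | t != - w) Q e t)%N.
  have ifE (b : bool) : (if b then 1 else 0)%N = b by case: b.
  rewrite /cyc -sum1_card big_mkcond /= (bigD1 (- w)) //= inE ifE; congr addn.
  by apply: eq_bigr => t _; rewrite inE ifE.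
have -> : #|[set t : F | (t != - w) && (Q (d * w) t || Q (d * w ^+ 2) t)]| =
    (\sum_(t | t != - w) Q (d * w)%R t + \sum_(t | t != - w) Q (d * w ^+ 2)%R t)%N.
  rewrite -sum1_card -big_split /= big_mkcond [RHS]big_mkcond; apply: eq_bigr => t _.
  by rewrite !inE; have := dis t; case: eqP => //= _; case: (Q _ t); case: (Q _ t).
have := cycQ (d * w); have := cycQ (d * w ^+ 2).
have wk k : w ^+ k \in [:: 1; w; w ^+ 2].
  by rewrite (cubic_mem w3 w1) -exprM mulnC exprM w3 expr1n.
have dw : d * w = w ^+ (2 * n + s + 1) by rewrite -dE expr1.
have w_eq1 k : (w ^+ k == 1) = (k == 0 %[mod 3]) by rewrite -(expr0 w) expr_cubic_eq.
(* Each cyclotomic number exceeds [cyc s 1 1] by one unless its label is 1, which happens for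
   exactly one of them when [s] and [n] differ modulo 3. The point [- w] is taken off once unless 3
   divides [n]. *)
rewrite !Qw !dw !(dE 2) !card_cyc_sqr // !w_eq1 !expr_cubic_eq.
move: (\sum_(t | _) _)%N (\sum_(t | _) _)%N => S1 S2; move: (cyc _ _ _) => A.
clear; lia.
Qed.

End PermutationCount.

Theorem theorem4p5 (p k : nat) (F : finFieldType) (n : nat) :
  prime p -> (0 < k)%N -> #|F| = (p ^ k)%N -> ((p ^ k) %% 3 = 1)%N ->
  (0 < n)%N -> coprime n ((p ^ k).-1 %/ 3) ->
  let q := (p ^ k)%N in
  let eps1 : algC := if ((q%:Z - 3 * n%:Z) %% 9)%Z == 1 then -2 else 1 in
  let eps2 : algC := if (n %% 3 == 0)%N then -2 else 1 in
  (#|[set a : F | is_permpoly ('X^n * ('X^(q.-1 %/ 3) + a%:P))]|%:R : algC)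
  = (2 * q%:R - 3 * (eps1 + eps2) - 10
     - 2 * (pi_p p ^+ k + (pi_p p)^* ^+ k)) / 9.
Proof.
move=> p_pr k0 cardFp q3 n0 cop q eps1 eps2.
pose s := (q.-1 %/ 3)%N.
have qs : q = (3 * s).+1 by rewrite /s; have := divn_eq q 3; rewrite q3; lia.
have cardF : #|F| = (3 * s).+1 by rewrite cardFp.
have [w w3 w1] := ex_cubic_root cardF.
rewrite (card_permpoly cardF w3 w1 n0 cop).
(* As [q - 1 = 3 * s], the condition modulo 9 says that [s] and [n] agree modulo 3. *)
have e1 : eps1 = 1 - 3 * (s == n %[mod 3])%:R.
  rewrite /eps1; have -> : (((q%:Z - 3 * n%:Z) %% 9)%Z == 1) = (s == n %[mod 3]).
    by rewrite qs; lia.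
  by case: eqP => _ /=; ring.
have e2 : eps2 = 1 - 3 * (3 %| n)%:R.
  by rewrite /eps2 /dvdn; case: eqP => _ /=; ring.
rewrite e1 e2 -[pi_p p ^+ k + _]opprK -(cyc11_pi_p p_pr cardFp qs) -/q.
rewrite natrD natrD natrM.
by field.
Qed.
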